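(* Let $\chi$ be transcendental over the field $K$, and let $\nu$ be a valuation on $K(\chi)$ or a pseudo-valuation of $K[\chi]$. Every key polynomial $\Phi$ for $\nu$ is an abstract key polynomial for $\nu$ (where, if $\nu$ is a pseudo-valuation, $\deg(\Phi)$ is assumed lower than the degree of a generator of the ideal $\{f\in K[\chi]:\nu(f)=\infty\}$ when that ideal is nonzero).
   Context: A pseudo-valuation $\nu$ of $K[\chi]$ is a map onto a linearly ordered abelian group together with $\infty$ having the properties of a valuation ($\nu(fg)=\nu(f)+\nu(g)$, $\nu(f+g)\ge\min(\nu(f),\nu(g))$, $\nu(0)=\infty$) except that $\nu(f)=\infty$ need not imply $f=0$; $\{f:\nu(f)=\infty\}$ is then a prime ideal. It is assumed that $\nu K$ has finite rank. For $\Phi$ monic of degree $d\ge1$ and $f,g\in K_{d-1}[\chi]$ (polynomials of degree at most $d-1$), let $q(f,g)$ and $r(f,g)$ be the quotient and remainder of the euclidean division of $fg$ by $\Phi$. $\Phi$ is a key polynomial for $\nu$ if for all nonzero $f,g\in K_{d-1}[\chi]$ we have $\nu(fg)=\nu(r(f,g))<\nu(q(f,g)\Phi)$. For a polynomial $f$ and $i\ge1$, $f_{(i)}=\frac{1}{i!}f^{(i)}$ is the $i$-th formal (Hasse) derivative, the division by $i!$ being done formally before reducing modulo the characteristic. For $f\ne0$, $\varepsilon_\nu(f)$ is the maximum over $i\ge1$ of $\frac{\nu(f)-\nu(f_{(i)})}{i}$ (in the divisible hull of the value group, with value $-\infty$ when $\nu(f_{(i)})=\infty$). A (non constant) polynomial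 $\Phi$ is an abstract key polynomial for $\nu$ if it is monic and for every nonzero $f\in K[\chi]$ such that $\varepsilon_\nu(f)\ge\varepsilon_\nu(\Phi)$ we have $\deg(f)\ge\deg(\Phi)$. *)

(* Defs.v *)
From HB Require Import structures.
From mathcomp Require Import all_boot all_order all_algebra.
From mathcomp Require Import fraction generic_quotient.
From mathcomp Require Import classical_sets cardinality.
From mathcomp Require Import zify.

Set Implicit Arguments.
Unset Strict Implicit.
Unset Printing Implicit Defensive.

Import Order.TTheory GRing.Theory.
Local Open Scope ring_scope.

(* Totality is a field here, and [Order.Total] is derived below, because Hierarchy
   Builder refuses a structure over both [Order.Total] and [Num.POrderedZmodule]
   declared after [Num.RealDomain]. *)
HB.mixin Record POrderedZmodule_isOrderedGroup G of Num.POrderedZmodule G := {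
  oag_le_total : total (<=%R : rel G);
  oag_lerD2 : forall z x y : G, x <= y -> z + x <= z + y
}.

#[short(type="oagType")]
HB.structure Definition OrderedAbelianGroup :=
  { G of Num.POrderedZmodule G & POrderedZmodule_isOrderedGroup G }.

HB.instance Definition _ (G : oagType) :=
  Order.POrder_isTotal.Build ring_display (OrderedAbelianGroup.sort G)
    oag_le_total.

Section OrderedGroupTheory.
Variable G : oagType.
Implicit Types x y z : G.

Lemma oag_leD2l z x y : (z + x <= z + y) = (x <= y).
Proof.
apply/idP/idP => [h|]; last exact: oag_lerD2.
by have := oag_lerD2 (- z) _ _ h; rewrite !addKr.
Qed.

Lemma oag_leD2r z x y : (x + z <= y + z) = (x <= y).
Proof. by rewrite ![_ + z]addrC oag_leD2l. Qed.

Lemma oag_leD x y z t : x <= y -> z <= t -> x + z <= y + t.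
Proof.
move=> xy zt; apply: (@le_trans _ _ (y + z)); first by rewrite oag_leD2r.
by rewrite oag_leD2l.
Qed.

Lemma oag_leMn n x y : (x *+ n.+1 <= y *+ n.+1) = (x <= y).
Proof.
have homo k (a b : G) : a <= b -> a *+ k <= b *+ k.
  move=> ab; elim: k => [|k IH]; first by rewrite !mulr0n lexx.
  by rewrite !mulrS; apply: oag_leD.
apply/idP/idP => [h|]; last exact: homo.
case: (leP x y) => // yx.
have e : x *+ n.+1 = y *+ n.+1.
  by apply/le_anti; rewrite h /=; apply/homo/ltW.
move: e; rewrite !mulrS => e.
have : x + y *+ n <= y + y *+ n by rewrite -e oag_leD2l; apply/homo/ltW.
by rewrite oag_leD2r leNgt yx.
Qed.

Lemma oag_injMn n : injective (fun x : G => x *+ n.+1).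
Proof.
by move=> x y /= e; apply/le_anti; rewrite -(oag_leMn n) -[y <= x](oag_leMn n) e lexx.
Qed.

End OrderedGroupTheory.

Section DivisibleHull.
Variable G : oagType.
Local Open Scope quotient_scope.

(* The divisible hull is a quotient of pairs; [(x, n)] stands for [x / n.+1]. *)
Definition hull_eq (p q : G * nat) : bool := p.1 *+ q.2.+1 == q.1 *+ p.2.+1.

Lemma hull_eq_refl : reflexive hull_eq.
Proof. by move=> p; rewrite /hull_eq. Qed.

Lemma hull_eq_sym : symmetric hull_eq.
Proof. by move=> p q; rewrite /hull_eq eq_sym. Qed.

Lemma hull_eq_trans : transitive hull_eq.
Proof.
move=> q p r /eqP pq /eqP qr; apply/eqP/(@oag_injMn _ q.2) => /=.
by rewrite mulrnAC pq mulrnAC qr mulrnAC.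
Qed.

Canonical hull_equiv := EquivRel hull_eq hull_eq_refl hull_eq_sym hull_eq_trans.

Definition hull : Type := {eq_quot hull_eq}.
HB.instance Definition _ : EqQuotient _ hull_eq hull := EqQuotient.on hull.
HB.instance Definition _ := Choice.on hull.

(* [hull_frac x n] is [x / n], for [0 < n] only. *)
Definition hull_frac (x : G) (n : nat) : hull := \pi_hull (x, n.-1).

Lemma hull_piE p q : (\pi_hull p == \pi_hull q) = hull_eq p q.
Proof. exact: eqmodE. Qed.

Lemma hull_repr p : hull_eq (repr (\pi_hull p)) p.
Proof. by rewrite -hull_piE reprK. Qed.

Definition hull_le_pair (p q : G * nat) : bool := p.1 *+ q.2.+1 <= q.1 *+ p.2.+1.

Lemma hull_le_pairE p p' q q' : hull_eq p p' -> hull_eq q q' ->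
  hull_le_pair p q = hull_le_pair p' q'.
Proof.
move=> /eqP pp /eqP qq; rewrite /hull_le_pair.
rewrite -(oag_leMn p'.2) -[LHS](oag_leMn q'.2).
rewrite -[RHS](oag_leMn p.2) -[RHS](oag_leMn q.2).
have a1 : p.1 *+ q.2.+1 *+ p'.2.+1 *+ q'.2.+1
         = p'.1 *+ q'.2.+1 *+ p.2.+1 *+ q.2.+1.
  by rewrite (mulrnAC p.1) pp -!mulrnA; congr (_ *+ _); lia.
have a2 : q.1 *+ p.2.+1 *+ p'.2.+1 *+ q'.2.+1
         = q'.1 *+ p'.2.+1 *+ p.2.+1 *+ q.2.+1.
  by rewrite mulrnAC (mulrnAC q.1) qq -!mulrnA; congr (_ *+ _); lia.
by rewrite a1 a2.
Qed.

Definition hull_le (x y : hull) : bool := hull_le_pair (repr x) (repr y).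

Lemma hull_le_pi p q : hull_le (\pi_hull p) (\pi_hull q) = hull_le_pair p q.
Proof. by apply: hull_le_pairE; apply: hull_repr. Qed.

Lemma hull_le_anti : antisymmetric hull_le.
Proof.
elim/quotW => p; elim/quotW => q; rewrite !hull_le_pi => /andP[pq qp].
by apply/eqP; rewrite hull_piE; apply/eqP/le_anti/andP.
Qed.

Lemma hull_le_trans : transitive hull_le.
Proof.
elim/quotW => q; elim/quotW => p; elim/quotW => r.
rewrite !hull_le_pi /hull_le_pair => pq qr.
rewrite -(oag_leMn q.2) mulrnAC; apply: (@le_trans _ _ (q.1 *+ p.2.+1 *+ r.2.+1)).
  by rewrite oag_leMn.
by rewrite mulrnAC [leRHS]mulrnAC oag_leMn.
Qed.

Lemma hull_le_total : total hull_le.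
Proof.
by elim/quotW => p; elim/quotW => q; rewrite !hull_le_pi; apply: le_total.
Qed.

Definition hull_add_pair (p q : G * nat) : G * nat :=
  (p.1 *+ q.2.+1 + q.1 *+ p.2.+1, (p.2.+1 * q.2.+1).-1).

Lemma hull_add_pair1 p q :
  (hull_add_pair p q).1 = p.1 *+ q.2.+1 + q.1 *+ p.2.+1.
Proof. by []. Qed.

Lemma hull_add_pair2 p q : (hull_add_pair p q).2.+1 = (p.2.+1 * q.2.+1)%N.
Proof. by rewrite prednK. Qed.

Definition hull_add (x y : hull) : hull :=
  \pi_hull (hull_add_pair (repr x) (repr y)).
Definition hull_opp (x : hull) : hull := \pi_hull (- (repr x).1, (repr x).2).
Definition hull_zero : hull := \pi_hull (0, 0%N).

Lemma hull_add_pi p q :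
  hull_add (\pi_hull p) (\pi_hull q) = \pi_hull (hull_add_pair p q).
Proof.
apply/eqP; rewrite hull_piE /hull_eq !hull_add_pair2 !hull_add_pair1; apply/eqP.
set p' := repr _; set q' := repr _.
have /eqP pp : hull_eq p' p by exact: hull_repr.
have /eqP qq : hull_eq q' q by exact: hull_repr.
rewrite !mulrnDl -!mulrnA; congr (_ + _).
  have -> : (q'.2.+1 * (p.2.+1 * q.2.+1) = p.2.+1 * (q'.2.+1 * q.2.+1))%N by lia.
  by rewrite mulrnA pp -!mulrnA; congr (_ *+ _); lia.
have -> : (p'.2.+1 * (p.2.+1 * q.2.+1) = q.2.+1 * (p'.2.+1 * p.2.+1))%N by lia.
by rewrite mulrnA qq -!mulrnA; congr (_ *+ _); lia.
Qed.

Lemma hull_opp_pi p : hull_opp (\pi_hull p) = \pi_hull (- p.1, p.2).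
Proof.
apply/eqP; rewrite hull_piE /hull_eq /= !mulNrn eqr_opp.
exact: hull_repr.
Qed.

Lemma hull_addA : associative hull_add.
Proof.
elim/quotW => p; elim/quotW => q; elim/quotW => r.
rewrite (hull_add_pi q r) (hull_add_pi p q) !hull_add_pi.
apply/eqP; rewrite hull_piE /hull_eq.
rewrite !(hull_add_pair2, hull_add_pair1) !mulrnDl -!mulrnA addrA.
by apply/eqP; congr (_ *+ _ + _ *+ _ + _ *+ _); lia.
Qed.

Lemma hull_addC : commutative hull_add.
Proof.
elim/quotW => p; elim/quotW => q; rewrite !hull_add_pi /hull_add_pair.
by rewrite addrC mulnC.
Qed.

Lemma hull_add0 : left_id hull_zero hull_add.
Proof.
elim/quotW => p; rewrite hull_add_pi; congr (\pi_hull _).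
by case: p => x n; rewrite /hull_add_pair mul1n mul0rn add0r mulr1n.
Qed.

Lemma hull_addN : left_inverse hull_zero hull_opp hull_add.
Proof.
elim/quotW => p; rewrite hull_opp_pi hull_add_pi; apply/eqP.
by rewrite hull_piE /hull_eq hull_add_pair1 /= mulNrn addNr !mul0rn.
Qed.

HB.instance Definition _ :=
  GRing.isZmodule.Build hull hull_addA hull_addC hull_add0 hull_addN.

Lemma hull_le_refl : reflexive hull_le.
Proof. by move=> x; case/orP: (hull_le_total x x). Qed.

HB.instance Definition _ := Order.Le_isPOrder.Build ring_display hull
  hull_le_refl hull_le_anti hull_le_trans.
HB.instance Definition _ :=
  Order.POrder_isTotal.Build ring_display hull hull_le_total.

Lemma hull_lerD2 (z x y : hull) : x <= y -> z + x <= z + y.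
Proof.
elim/quotW: z => r; elim/quotW: x => p; elim/quotW: y => q.
have addE a b : \pi_hull a + \pi_hull b = \pi_hull (hull_add_pair a b).
  exact: hull_add_pi.
rewrite !addE.
have leE a b : (\pi_hull a <= \pi_hull b) = hull_le_pair a b.
  exact: hull_le_pi.
rewrite !leE /hull_le_pair !hull_add_pair2 !hull_add_pair1 => pq.
rewrite !mulrnDl -!mulrnA.
have -> : (p.2.+1 * (r.2.+1 * q.2.+1) = q.2.+1 * (r.2.+1 * p.2.+1))%N by lia.
rewrite oag_leD2l.
have -> : (r.2.+1 * (r.2.+1 * q.2.+1) = q.2.+1 * (r.2.+1 * r.2.+1))%N by lia.
have -> : (r.2.+1 * (r.2.+1 * p.2.+1) = p.2.+1 * (r.2.+1 * r.2.+1))%N by lia.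
by rewrite !mulrnA !oag_leMn.
Qed.

HB.instance Definition _ :=
  POrderedZmodule_isOrderedGroup.Build hull hull_le_total hull_lerD2.

Lemma hull_le_frac (x y : G) m n : (0 < m)%N -> (0 < n)%N ->
  (hull_frac x m <= hull_frac y n) = (x *+ n <= y *+ m).
Proof. by case: m n => // m [] // n _ _; exact: hull_le_pi. Qed.

Lemma hull_fracD (x y : G) : hull_frac (x + y) 1 = hull_frac x 1 + hull_frac y 1.
Proof.
by apply: esym; have := hull_add_pi (x, 0%N) (y, 0%N); rewrite /hull_add_pair /= !mulr1n.
Qed.

Lemma hull_fracMn (x : G) n : (0 < n)%N -> hull_frac x n *+ n = hull_frac x 1.
Proof.
case: n => // n _; rewrite /hull_frac /=.
have E k : \pi_hull (x, n) *+ k.+1 = \pi_hull (x *+ k.+1, n).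
  elim: k => [//|k IH]; rewrite mulrS IH.
  have -> : \pi_hull (x, n) + \pi_hull (x *+ k.+1, n)
          = \pi_hull (hull_add_pair (x, n) (x *+ k.+1, n)) by exact: hull_add_pi.
  apply/eqP; rewrite hull_piE /hull_eq hull_add_pair2 hull_add_pair1 /=.
  by rewrite -mulrnDl -mulrS mulrnA.
by rewrite E; apply/eqP; rewrite hull_piE /hull_eq /= mulr1n.
Qed.

End DivisibleHull.

Variant withtop (T : Type) : Type := Fin of T | Infty.
Arguments Infty {T}.

Section WithTop.
Variable T : orderType ring_display.

Definition withtop_opt (x : withtop T) : option T :=
  if x is Fin a then Some a else None.
Definition opt_withtop (x : option T) : withtop T :=
  if x is Some a then Fin a else Infty.
Lemma withtop_optK : cancel withtop_opt opt_withtop. Proof. by case. Qed.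

HB.instance Definition _ := Choice.copy (withtop T) (can_type withtop_optK).

Definition withtop_le (x y : withtop T) : bool :=
  match x, y with
  | _, Infty => true
  | Infty, Fin _ => false
  | Fin a, Fin b => a <= b
  end.

Lemma withtop_le_anti : antisymmetric withtop_le.
Proof. by case=> [a|] [b|] //= /le_anti ->. Qed.
Lemma withtop_le_trans : transitive withtop_le.
Proof. by case=> [a|] [b|] [c|] //=; apply: le_trans. Qed.
Lemma withtop_le_total : total withtop_le.
Proof. by case=> [a|] [b|] //=; apply: le_total. Qed.
Lemma withtop_le_refl : reflexive withtop_le.
Proof. by case=> /=. Qed.

HB.instance Definition _ := Order.Le_isPOrder.Build ring_display (withtop T)
  withtop_le_refl withtop_le_anti withtop_le_trans.
HB.instance Definition _ :=
  Order.POrder_isTotal.Build ring_display (withtop T) withtop_le_total.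

End WithTop.

Definition withtop_add (G : zmodType) (x y : withtop G) : withtop G :=
  match x, y with
  | Fin a, Fin b => Fin (a + b)
  | _, _ => Infty
  end.

Variant withbot (T : Type) : Type := MinusInfty | Above of T.
Arguments MinusInfty {T}.

Section WithBot.
Variable T : orderType ring_display.

Definition withbot_opt (x : withbot T) : option T :=
  if x is Above a then Some a else None.
Definition opt_withbot (x : option T) : withbot T :=
  if x is Some a then Above a else MinusInfty.
Lemma withbot_optK : cancel withbot_opt opt_withbot. Proof. by case. Qed.

HB.instance Definition _ := Choice.copy (withbot T) (can_type withbot_optK).

Definition withbot_le (x y : withbot T) : bool :=
  match x, y with
  | MinusInfty, _ => true
  | Above _, MinusInfty => false
  | Above a, Above b => a <= b
  end.

Lemma withbot_le_anti : antisymmetric withbot_le.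
Proof. by case=> [|a] [|b] //= /le_anti ->. Qed.
Lemma withbot_le_trans : transitive withbot_le.
Proof. by case=> [|a] [|b] [|c] //=; apply: le_trans. Qed.
Lemma withbot_le_total : total withbot_le.
Proof. by case=> [|a] [|b] //=; apply: le_total. Qed.
Lemma withbot_le_refl : reflexive withbot_le.
Proof. by case=> /=. Qed.

HB.instance Definition _ := Order.Le_isPOrder.Build ring_display (withbot T)
  withbot_le_refl withbot_le_anti withbot_le_trans.
HB.instance Definition _ :=
  Order.POrder_isTotal.Build ring_display (withbot T) withbot_le_total.

Lemma withbot_le0 (x : withbot T) : MinusInfty <= x.
Proof. by []. Qed.

End WithBot.

(* The values are only required to lie in [G], not to exhaust it: on a ring the
   finite values need not form a subgroup. The clause [nu 1 = 0] excludes the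
   constant map [Infty]. *)
Definition is_pseudo_valuation (R : comNzRingType) (G : oagType)
    (nu : R -> withtop G) : Prop :=
  [/\ nu 0 = Infty,
      nu 1 = Fin 0,
      forall f g, nu (f * g) = withtop_add (nu f) (nu g)
    & forall f g, Order.min (nu f) (nu g) <= nu (f + g)].

Definition is_valuation (R : comNzRingType) (G : oagType)
    (nu : R -> withtop G) : Prop :=
  is_pseudo_valuation nu /\ forall f, nu f = Infty -> f = 0.

Definition convex_subgroup (G : oagType) (A C : set G) : Prop :=
  [/\ (C `<=` A)%classic,
      C 0,
      forall x y, C x -> C y -> C (x - y)
    & forall x y, C x -> A y -> 0 <= y <= x -> C y].

Section KeyPolynomials.
Variables (K : fieldType) (G : oagType).
Implicit Type nu : {poly K} -> withtop G.

Definition base_value_group nu : set G :=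
  [set x | exists2 a : K, a != 0 & nu a%:P = Fin x]%classic.

Definition base_finite_rank nu : Prop :=
  finite_set [set C | convex_subgroup (base_value_group nu) C]%classic.

Definition support_generator nu (g : {poly K}) : Prop :=
  forall f, nu f = Infty <-> g %| f.

(* With [d] the degree of [Phi], [size f < size Phi] says that [deg f <= d - 1]. *)
Definition key_polynomial nu (Phi : {poly K}) : Prop :=
  [/\ Phi \is monic, (1 < size Phi)%N
    & forall f g : {poly K}, f != 0 -> g != 0 ->
        (size f < size Phi)%N -> (size g < size Phi)%N ->
        nu (f * g) = nu ((f * g) %% Phi) /\
        nu ((f * g) %% Phi) < nu ((f * g) %/ Phi * Phi)].

(* [(a - b) / i]. The clause for [b = Infty] comes first, so that it also decides
   [Infty - Infty]. *)
Definition slope (a b : withtop G) (i : nat) : withbot (withtop (hull G)) :=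
  match a, b with
  | _, Infty => MinusInfty
  | Infty, Fin _ => Above Infty
  | Fin x, Fin y => Above (Fin (hull_frac (x - y) i))
  end.

(* The indices above the degree of [f] contribute only [MinusInfty];
   see [epsilonP]. *)
Definition epsilon nu (f : {poly K}) : withbot (withtop (hull G)) :=
  \big[Order.max/MinusInfty]_(1 <= i < size f) slope (nu f) (nu f^`N(i)) i.

Lemma epsilonP nu (f : {poly K}) : nu 0 = Infty ->
  (forall i, (0 < i)%N -> slope (nu f) (nu f^`N(i)) i <= epsilon nu f) /\
  (exists2 i, (0 < i)%N & slope (nu f) (nu f^`N(i)) i = epsilon nu f).
Proof.
move=> nu0; pose F i := slope (nu f) (nu f^`N(i)) i.
have big0 i : (size f <= i)%N -> F i = MinusInfty.
  move=> si; rewrite /F; suff -> : f^`N(i) = 0 by rewrite nu0; case: (nu f).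
  apply/polyP => j; rewrite coef_nderivn coef0 nth_default ?mul0rn //.
  by rewrite (leq_trans si) ?leq_addr.
split=> [i i0|].
  case: (leqP (size f) i) => [si|si]; first by rewrite -/(F i) big0.
  rewrite /epsilon big_seq; apply: (@le_bigmax_seq _ _ _ _ _ i _ F).
    by rewrite mem_index_iota i0.
  by rewrite mem_index_iota i0.
have : epsilon nu f = MinusInfty \/
    exists2 i, i \in index_iota 1 (size f) & F i = epsilon nu f.
  rewrite /epsilon; elim: (index_iota _ _) => [|j s IH].
    by left; rewrite big_nil.
  rewrite big_cons maxEle; case: ifP => _; last first.
    by right; exists j; rewrite ?mem_head.
  by case: IH => [->|[i si <-]]; [left | right; exists i; rewrite // in_cons si orbT].
case=> [->|[i]]; first by exists (size f).+1; rewrite // -/(F _) big0.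
by rewrite mem_index_iota => /andP[i0 _] <-; exists i.
Qed.

Definition abstract_key_polynomial nu (Phi : {poly K}) : Prop :=
  [/\ Phi \is monic, (1 < size Phi)%N
    & forall f : {poly K}, f != 0 -> epsilon nu Phi <= epsilon nu f ->
        (size Phi <= size f)%N].

End KeyPolynomials.

(* Main.v *)
(** For a polynomial [f] and a rational value [b], consider the weights
    [nu f_(i) + i b] of the terms of the Taylor expansion [f(x + t)]; then
    [epsilon f < b] says that the weight at [i = 0] is strictly smaller than all
    the others. Let [b = epsilon Phi] and let [f], of degree [< deg Phi], be of
    minimal degree with [epsilon f >= b]. Write [Phi = q f + r]. As [Phi] is a key
    polynomial, [nu r = nu (q f) < nu Phi], and [epsilon r < b] by minimality, so
    the terms of [q f = Phi - r] at [i > 0] have weight [> nu (q f)]. Hence the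
    initial form in [t] of [(q f)(x + t)] has degree 0, so that of [f(x + t)] has
    degree 0 too, that is [epsilon f < b]. *)

Require Import Defs.
From mathcomp Require Import all_boot all_order all_algebra fraction.
From mathcomp Require Import zify ring.
Import Order.TTheory GRing.Theory.
Local Open Scope ring_scope.

(** * Leibniz rule for Hasse derivatives *)

Lemma nderivnM (R : comNzRingType) (p q : {poly R}) n :
  (p * q)^`N(n) = \sum_(i < n.+1) p^`N(i) * q^`N(n - i).
Proof.
elim/poly_ind: p n => [|p c IH] n.
  by rewrite mul0r linear0 big1 // => i _; rewrite linear0 mul0r.
case: n => [|n]; first by rewrite big_ord1 !nderivn0.
(* The summand [0%:P] gives the shape to which [nderivnMXaddC] applies. *)
have -> : (p * 'X + c%:P) * q = (p * q * 'X + 0%:P) + c *: q.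
  by rewrite mulrDl mulrAC addr0 mul_polyC.
rewrite nderivnD nderivnZ nderivnMXaddC !IH [in RHS]big_ord_recl nderivn0 subn0.
under [X in _ = _ + X]eq_bigr => i _ do
  rewrite lift0 nderivnMXaddC subSS mulrDl (mulrAC _ 'X).
rewrite big_split /= -mulr_suml [X in X * 'X]big_ord_recl nderivn0 subn0.
under [X in (_ + X) * 'X]eq_bigr => i _ do rewrite lift0 subSS.
rewrite !mulrDl -mul_polyC (mulrAC p); ring.
Qed.

(** * Arithmetic and order of values with infinity *)

Section WithTopTheory.
Variable G : oagType.
Implicit Types (x y z : withtop G) (a b : G).

Lemma oag_ltD2r a b c : (a < b) = (a + c < b + c).
Proof. by rewrite !ltNge oag_leD2r. Qed.

Lemma lt_Fin a b : (Fin a < Fin b) = (a < b).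
Proof. by rewrite !ltNge. Qed.

Lemma le_Fin a b : (Fin a <= Fin b) = (a <= b).
Proof. by []. Qed.

Lemma le_Infty x : x <= Infty.
Proof. by case: x. Qed.

Lemma lt_FinInfty a : Fin a < Infty.
Proof. by rewrite ltNge. Qed.

Lemma withtop_addC x y : withtop_add x y = withtop_add y x.
Proof. by case: x y => [a|] [b|] //=; rewrite addrC. Qed.

Lemma withtop_addACA x y z t :
  withtop_add (withtop_add x y) (withtop_add z t) =
  withtop_add (withtop_add x z) (withtop_add y t).
Proof. by case: x y z t => [a|] [b|] [c|] [d|] //=; rewrite addrACA. Qed.

Lemma withtop_leD x y z t :
  x <= y -> z <= t -> withtop_add x z <= withtop_add y t.
Proof.
case: x y z t => [a|] [b|] [c|] [d|] //=; rewrite !le_Fin; exact: oag_leD.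
Qed.

Lemma withtop_ltD a x b y :
  Fin a < x -> Fin b <= y -> Fin (a + b) < withtop_add x y.
Proof.
case: x y => [c|] [d|] //= ac bd; rewrite ?lt_FinInfty // lt_Fin.
rewrite lt_Fin in ac; apply: (@lt_le_trans _ _ (c + b)).
  by rewrite -oag_ltD2r.
by rewrite oag_leD2l.
Qed.

(** Trades a bound on a weight for a bound on the value itself, to which the ultrametric inequality
    applies. *)
Lemma withtop_ltBl a b x :
  (Fin (a - b) < x) = (Fin a < withtop_add x (Fin b)).
Proof.
by case: x => [c|]; rewrite ?lt_FinInfty //= !lt_Fin (oag_ltD2r _ _ b) subrK.
Qed.

End WithTopTheory.

(** * Pseudo-valuations of opposites and sums *)

Section PseudoValuation.
Variables (R : comNzRingType) (G : oagType) (nu : R -> withtop G).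
Hypothesis nuP : is_pseudo_valuation nu.

(** Twice [nu (-1)] is [nu 1 = 0], and an ordered group has no torsion. *)
Lemma pseudo_valN f : nu (- f) = nu f.
Proof.
case: nuP => _ nu1 nuM _.
have : nu (-1) = Fin 0.
  have := nuM (-1) (-1); rewrite mulrNN mulr1 nu1.
  case: (nu (-1)) => [a|] //= [e]; congr Fin; apply: (@oag_injMn _ 1).
  by rewrite mul0rn mulr2n -e.
move=> nuN1; rewrite -mulN1r nuM nuN1.
by case: (nu f) => [a|] //=; rewrite add0r.
Qed.

Lemma pseudo_valD_gt a f g : Fin a < nu f -> Fin a < nu g -> Fin a < nu (f + g).
Proof.
case: nuP => _ _ _ nuD af ag; apply: lt_le_trans (nuD f g).
by rewrite lt_min af.
Qed.

Lemma pseudo_val_sum_gt a (I : finType) (P : pred I) (F : I -> R) :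
  (forall i, P i -> Fin a < nu (F i)) -> Fin a < nu (\sum_(i | P i) F i).
Proof.
case: nuP => nu0 _ _ _ aF; elim/big_ind: _ => //; last exact: pseudo_valD_gt.
by rewrite nu0 lt_FinInfty.
Qed.

End PseudoValuation.

(** * Initial forms of Taylor expansions *)

Lemma last_min (T : orderType ring_display) (F : nat -> T) n :
  exists2 m, (m <= n)%N & forall i, (i <= n)%N ->
    F m <= F i /\ ((m < i)%N -> F m < F i).
Proof.
elim: n => [|n [m mn mP]].
  by exists 0%N => // i; rewrite leqn0 => /eqP ->.
(* On a tie the later index wins: the last index of minimal weight is the degree in [t] of the
   initial form. *)
case: (leP (F n.+1) (F m)) => [le|lt].
  exists n.+1 => // i; rewrite leq_eqVlt => /orP[/eqP ->|ltin].
    by rewrite ltnn.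
  split; first by case: (mP i ltin) => h _; apply: le_trans h.
  by move=> h; have := ltn_trans h ltin; rewrite ltnn.
exists m => [|i]; first exact: leqW.
rewrite leq_eqVlt => /orP[/eqP ->|]; last exact: mP.
by rewrite (ltW lt).
Qed.

Section TaylorWeights.
Variables (R : comNzRingType) (G : oagType) (nu : {poly R} -> withtop G) (b : G).
Hypothesis nuP : is_pseudo_valuation nu.

(* The weight of the [i]-th term of the Taylor expansion
   [f(x + t) = \sum_i f^`N(i) t^i], when [t] is given the value [b]. *)
Definition taylor_weight (f : {poly R}) i :=
  withtop_add (nu f^`N(i)) (Fin (b *+ i)).

Lemma taylor_weight0 f : taylor_weight f 0 = nu f.
Proof.
by rewrite /taylor_weight nderivn0; case: (nu f) => [a|] //=; rewrite addr0.
Qed.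

(** Here [a] is the weight of the initial form of [f(x + t)] and [m] its degree in [t]. The minimum
    is finite because the weight at 0 is [nu f]. *)
Lemma taylor_weight_last_min f : nu f != Infty ->
  exists a m, [/\ taylor_weight f m = Fin a, Fin a <= nu f,
    forall i, Fin a <= taylor_weight f i &
    forall i, (m < i)%N -> Fin a < taylor_weight f i].
Proof.
move=> nuf; have [nu0 _ _ _] := nuP.
have [m _ mP] := last_min _ (taylor_weight f) (size f).
have := (mP 0%N isT).1; rewrite taylor_weight0.
case e: (taylor_weight f m) => [a|] h; last by case: (nu f) h nuf.
have big i : (size f < i)%N -> taylor_weight f i = Infty.
  by move=> /ltnW si; rewrite /taylor_weight nderivn_poly0 // nu0.
exists a, m; split=> // i; case: (leqP i (size f)) => [/mP[]|/big ->].
- by rewrite e.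
- by rewrite le_Infty.
- by rewrite e.
by rewrite lt_FinInfty.
Qed.

(* The initial form of a product is the product of the initial forms, so its
   degree in [t] is the sum of theirs. *)
Lemma taylor_weightM f g a m c n :
  taylor_weight f m = Fin a -> taylor_weight g n = Fin c ->
  (forall i, Fin a <= taylor_weight f i) ->
  (forall i, Fin c <= taylor_weight g i) ->
  (forall i, (m < i)%N -> Fin a < taylor_weight f i) ->
  (forall i, (n < i)%N -> Fin c < taylor_weight g i) ->
  taylor_weight (f * g) (m + n) <= Fin (a + c).
Proof.
move=> em en lef leg ltf ltg; have [nu0 _ nuM _] := nuP.
rewrite leNgt; apply/negP; rewrite -withtop_ltBl nderivnM.
have wM i : (i <= m + n)%N ->
    withtop_add (nu (f^`N(i) * g^`N(m + n - i))) (Fin (b *+ (m + n))) =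
    withtop_add (taylor_weight f i) (taylor_weight g (m + n - i)).
  by move=> le; rewrite withtop_addACA -nuM /= -mulrnDr subnKC.
have lmn : (m < (m + n).+1)%N by rewrite ltnS leq_addr.
(* The term [i = m] has weight exactly [a + c], but it is the difference of the whole sum, assumed
   heavier, and of the other terms, all heavier. *)
rewrite (bigD1 (Ordinal lmn)) //= => lt.
suff : Fin (a + c - b *+ (m + n)) < nu (f^`N(m) * g^`N(m + n - m)).
  by rewrite withtop_ltBl wM ?leq_addr // addKn em en lt_Fin ltxx.
rewrite -[_ * _](addrK (\sum_(i < (m + n).+1 | i != Ordinal lmn)
  f^`N(i) * g^`N(m + n - i))).
apply: pseudo_valD_gt => //; rewrite pseudo_valN //.
apply: pseudo_val_sum_gt => // i ne.
rewrite withtop_ltBl wM; last by rewrite -ltnS.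
case: (ltngtP i m) => [im|mi|e]; last by case/eqP: ne; apply/val_inj.
  (* Here [m + n - i] exceeds [n]. *)
  rewrite withtop_addC addrC; apply: withtop_ltD => //; apply: ltg.
  by have := ltn_ord i; lia.
exact: withtop_ltD (ltf _ mi) (leg _).
Qed.

(** The initial form of the product has degree 0 in [t], so those of both factors do. *)
Lemma taylor_weight_factor f g : nu f != Infty -> nu g != Infty ->
  (forall i, (0 < i)%N -> nu (f * g) < taylor_weight (f * g) i) ->
  forall i, (0 < i)%N -> nu g < taylor_weight g i.
Proof.
move=> nuf nug lt.
have [a [m [em af lef ltf]]] := taylor_weight_last_min f nuf.
have [c [n [en cg leg ltg]]] := taylor_weight_last_min g nug.
have := taylor_weightM _ _ _ _ _ _ em en lef leg ltf ltg.
case: (posnP (m + n)) => [/eqP|/lt lt_mn le].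
  rewrite addn_eq0 => /andP[_ /eqP n0] _ i i0.
  by rewrite -taylor_weight0 -n0 en ltg // n0.
(* If [m + n] were positive, its weight would exceed [nu (f * g)], which is at least [a + c]. *)
have [_ _ nuM _] := nuP; have := lt_le_trans lt_mn le.
rewrite ltNge nuM; case/negP; exact: (@withtop_leD _ (Fin a) _ (Fin c)).
Qed.

End TaylorWeights.

Arguments taylor_weight {R G}.

(** * Values and slopes in the divisible hull *)

Lemma le_Above (T : orderType ring_display) (x y : T) :
  (Above x <= Above y) = (x <= y).
Proof. by []. Qed.

(** The values of [epsilon], which serve as [b] in the weights, lie in the hull, so [nu] has to be
    carried there. *)
Definition hull_val {G : oagType} (x : withtop G) : withtop (hull G) :=
  if x is Fin a then Fin (hull_frac a 1) else Infty.

Section HullVal.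
Variable G : oagType.
Implicit Types (a : G) (x y : withtop G) (b : hull G).

Lemma hull_val_le x y : (hull_val x <= hull_val y) = (x <= y).
Proof. by case: x y => [a|] [c|] //=; rewrite !le_Fin hull_le_frac. Qed.

Lemma hull_val_lt x y : (hull_val x < hull_val y) = (x < y).
Proof. by rewrite !ltNge hull_val_le. Qed.

Lemma hull_val_pseudo_valuation (R : comNzRingType) (nu : R -> withtop G) :
  is_pseudo_valuation nu -> is_pseudo_valuation (fun f => hull_val (nu f)).
Proof.
case=> nu0 nu1 nuM nuD; split=> [||f g|f g].
- by rewrite nu0.
- by rewrite nu1; congr Fin; apply: (addIr (hull_frac 0 1));
    rewrite -hull_fracD add0r addr0.
- by rewrite nuM; case: (nu f) (nu g) => [a|] [c|] //=; rewrite hull_fracD.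
by move: (nuD f g); rewrite !ge_min !hull_val_le.
Qed.

(** Multiplying by [i] clears the denominator of the slope and yields the weight at [i]. *)
Lemma slope_le a y b i : (0 < i)%N ->
  (slope (Fin a) y i <= Above (Fin b)) =
  (hull_val (Fin a) <= withtop_add (hull_val y) (Fin (b *+ i))).
Proof.
case: y => [c|] // i0; rewrite /slope le_Above [LHS]le_Fin /hull_val [RHS]le_Fin.
rewrite -(@oag_leMn (hull G) i.-1 (hull_frac _ _) b) (prednK i0) hull_fracMn //.
by rewrite -(@oag_leD2r (hull G) (hull_frac c 1)) -hull_fracD subrK addrC.
Qed.

Lemma slope_lt a y b i : (0 < i)%N ->
  (slope (Fin a) y i < Above (Fin b)) =
  (hull_val (Fin a) < withtop_add (hull_val y) (Fin (b *+ i))).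
Proof.
case: y => [c|] // i0; rewrite /slope [LHS]ltNge le_Above le_Fin /hull_val.
rewrite [RHS]ltNge le_Fin.
congr negb; rewrite -(@oag_leMn (hull G) i.-1 b (hull_frac _ _)) (prednK i0).
rewrite hull_fracMn //.
by rewrite -(@oag_leD2r (hull G) (hull_frac c 1)) -hull_fracD subrK addrC.
Qed.

End HullVal.

(** * Bounds on [epsilon] as conditions on Taylor weights *)

Section Epsilon.
Variables (K : fieldType) (G : oagType) (nu : {poly K} -> withtop G).
Hypothesis nuP : is_pseudo_valuation nu.
Let mu f := hull_val (nu f).

Lemma epsilon_le f b i : nu f != Infty -> epsilon nu f <= Above (Fin b) ->
  (0 < i)%N -> mu f <= taylor_weight mu b f i.
Proof.
have [nu0 _ _ _] := nuP; have [slope_le_eps _] := epsilonP f nu0.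
case e: (nu f) slope_le_eps => [a|] // h _ le i0.
by rewrite /mu e -slope_le // (le_trans _ le) // h.
Qed.

(** The maximum [epsilon] is attained, so it is below a bound as soon as every slope is. *)
Lemma epsilon_ltP f b : nu f != Infty ->
  (epsilon nu f < Above (Fin b)) <->
  (forall i, (0 < i)%N -> mu f < taylor_weight mu b f i).
Proof.
have [nu0 _ _ _] := nuP; have [slope_le_eps [j j0 ej]] := epsilonP f nu0.
case e: (nu f) slope_le_eps ej => [a|] // h ej _; split=> [lt i i0|lt].
  by rewrite /mu e -slope_lt // (le_lt_trans _ lt) // h.
by rewrite -ej slope_lt // -e; apply: lt.
Qed.

End Epsilon.

(** This derivative has value 0, which keeps [epsilon nu Phi] above [MinusInfty]. *)
Lemma nderivn_monic (R : nzRingType) (p : {poly R}) :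
  p \is monic -> p^`N((size p).-1) = 1.
Proof.
move=> /monicP p1; have p0 : (0 < size p)%N.
  by rewrite size_poly_gt0 -lead_coef_eq0 p1 oner_neq0.
apply/polyP => i; rewrite coef_nderivn coef1.
case: i => [|i]; first by rewrite addn0 -/(lead_coef p) p1 binn.
by rewrite nth_default ?mul0rn // addnS -addSn prednK // leq_addr.
Qed.

(** * Key polynomials *)

Section KeyPolynomial.
Variables (K : fieldType) (G : oagType) (nu : {poly K} -> withtop G).
Hypothesis nuP : is_pseudo_valuation nu.
Variable Phi : {poly K}.
Hypothesis keyPhi : key_polynomial nu Phi.
Let mu f := hull_val (nu f).
Implicit Types f g : {poly K}.

(** With [g = 1] the key property puts [nu f] strictly below another value. *)
Lemma key_polynomial_val_fin f :
  f != 0 -> (size f < size Phi)%N -> nu f != Infty.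
Proof.
have [_ sPhi key] := keyPhi => f0 sf.
have [] := key f 1 f0 (oner_neq0 _) sf; rewrite ?size_poly1 // mulr1 => -> lt.
by apply/eqP => e; move: lt; rewrite e ltNge le_Infty.
Qed.

(** As [r] is shorter than [Phi], the equality [q * f = 1 * Phi - r] is also the euclidean division
    of [q * f] by [Phi], with quotient 1; the key property for [q] and [f] gives the values. *)
Lemma key_polynomial_division f :
  f != 0 -> (1 < size f)%N -> (size f < size Phi)%N ->
  exists q r : {poly K},
    [/\ Phi = q * f + r, q != 0, (size q < size Phi)%N,
      (size r < size f)%N & nu r = nu (q * f) /\ nu (q * f) < nu Phi].
Proof.
have [Phi_monic _ key] := keyPhi => f0 sf fPhi.
have Phi0 := monic_neq0 Phi_monic.
exists (Phi %/ f), (Phi %% f).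
have sr : (size (Phi %% f)%R < size f)%N by rewrite ltn_modp.
have q0 : Phi %/ f != 0 by rewrite divpN0 // ltnW.
(* The quotient is shorter than [Phi] because [f] is not constant. *)
have sq : (size (Phi %/ f)%R < size Phi)%N.
  by rewrite size_divp // ltn_subrL -ltnS prednK ?sf ?(ltn_trans _ fPhi) // ltnW.
split=> //; first exact: divp_eq.
have e : Phi %/ f * f = 1 * Phi + - (Phi %% f).
  by rewrite {2}(divp_eq Phi f) mul1r addrK.
have [] := key _ _ q0 f0 sq fPhi; rewrite e.
rewrite modp_addl_mul_small ?divp_addl_mul_small ?size_polyN ?(ltn_trans sr) //.
by rewrite (pseudo_valN _ _ _ nuP) mul1r => ->.
Qed.

Lemma key_polynomial_epsilon_lt f : f != 0 -> (size f < size Phi)%N ->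
  epsilon nu f < epsilon nu Phi.
Proof.
have [nu0 nu1 nuM nuD] := nuP; have [Phi_monic sPhi _] := keyPhi.
have [le_eps [j j0 ej]] := epsilonP Phi nu0.
have := le_eps (size Phi).-1; rewrite nderivn_monic // nu1 -subn1 subn_gt0.
move=> /(_ sPhi).
case e: (nu Phi) ej => [x|] /= ej lb f0 fPhi.
(* A finite [nu Phi] excludes [Above Infty], and [lb] excludes [MinusInfty]. *)
- have [b eb] : exists b, epsilon nu Phi = Above (Fin b).
    rewrite -ej; case: (nu _) ej => [y|] /= ej; first by eexists.
    by rewrite -ej in lb.
  rewrite eb; have [n] := ubnP (size f); elim: n => // n IH in f f0 fPhi *.
  rewrite ltnS => fn; case: (leqP (size f) 1) => [f1|f1].
    (* For a constant the maximum is empty, hence [MinusInfty]. *)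
    by rewrite /epsilon big_geq.
  have [q [r [Phi_eq q0 sq sr [nur lt]]]] := key_polynomial_division f f0 f1 fPhi.
  have r0 : r != 0.
    by apply/eqP => r0; move: lt; rewrite -nur r0 nu0 ltNge le_Infty.
  have rPhi := ltn_trans sr fPhi.
  have finr := key_polynomial_val_fin r r0 rPhi.
  have eps_r := IH r r0 rPhi (leq_trans sr fn).
  have muP : is_pseudo_valuation mu by exact: hull_val_pseudo_valuation.
  have fin_mu g : g != 0 -> (size g < size Phi)%N -> mu g != Infty.
    by move=> g0 /(key_polynomial_val_fin g g0); rewrite /mu; case: (nu g).
  apply/(epsilon_ltP _ _ _ nuP); first exact: key_polynomial_val_fin.
  apply: (taylor_weight_factor _ _ _ _ muP q).
  - exact: fin_mu.
  - exact: fin_mu.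
  move=> i i0.
  have mur : mu r = mu (q * f) by rewrite /mu nur.
  have {}lt : mu (q * f) < mu Phi by rewrite /mu hull_val_lt.
  have qf : q * f = Phi - r by rewrite Phi_eq addrK.
  have lePhi : mu Phi <= taylor_weight mu b Phi i.
    by apply: epsilon_le; rewrite ?e ?eb.
  have ltr : mu r < taylor_weight mu b r i.
    by apply: (epsilon_ltP _ _ _ nuP _ _ _).1.
  move: ltr (lt_le_trans lt lePhi); rewrite mur.
  rewrite /taylor_weight; case: (mu (q * f)) lt => [a|]; last first.
    by rewrite ltNge le_Infty.
  rewrite qf -!withtop_ltBl nderivnB => _ ltr ltPhi.
  by apply: pseudo_valD_gt => //; rewrite pseudo_valN.
(* Now [nu Phi] is infinite, and so is its slope in [lb], whereas the slopes of [f] stay below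
   [Above Infty] because [nu f] is finite. *)
have -> : epsilon nu Phi = Above Infty.
  by move: lb; case: (epsilon nu Phi) => [|[]].
have [_ [i i0 <-]] := epsilonP f nu0.
have := key_polynomial_val_fin f f0 fPhi.
by case: (nu f) => [a|] //; case: (nu _) => [c|] // _; rewrite ltNge.
Qed.

Lemma key_polynomial_abstract : abstract_key_polynomial nu Phi.
Proof.
have [Phi_monic sPhi _] := keyPhi; split=> // f f0.
case: (leqP (size Phi) (size f)) => // fPhi.
by rewrite leNgt key_polynomial_epsilon_lt.
Qed.

End KeyPolynomial.

Theorem corollary5p5 (K : fieldType) (G : oagType) :
  (forall nu : {fraction {poly K}} -> withtop G,
     is_valuation nu ->
     base_finite_rank (fun f : {poly K} => nu (tofrac f)) ->
     forall Phi : {poly K},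
       key_polynomial (fun f : {poly K} => nu (tofrac f)) Phi ->
       abstract_key_polynomial (fun f : {poly K} => nu (tofrac f)) Phi) /\
  (forall nu : {poly K} -> withtop G,
     is_pseudo_valuation nu ->
     base_finite_rank nu ->
     forall Phi : {poly K},
       key_polynomial nu Phi ->
       (forall g : {poly K},
          support_generator nu g -> g != 0 -> (size Phi < size g)%N) ->
       abstract_key_polynomial nu Phi).
Proof.
split=> [nu [nuP _] _ Phi keyPhi|nu nuP _ Phi keyPhi _].
  apply: key_polynomial_abstract keyPhi.
  (* A valuation of the fraction field restricts to a pseudo-valuation along the ring morphism
     [tofrac]. *)
  case: nuP => nu0 nu1 nuM nuD; split=> [||f g|f g].
  - by rewrite rmorph0.
  - by rewrite rmorph1.
  - by rewrite rmorphM.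
  by rewrite rmorphD.
exact: key_polynomial_abstract.
Qed.
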